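(* There exist absolute constants $c>0$ and $C>0$ such that the following holds. Let $n\ge 2$ be an integer and let $L,\mu,\Delta,\varepsilon>0$ satisfy $\kappa:=L/\mu\ge n/2+1$ and $\varepsilon/\Delta\le 0.00327$. Then for every PIFO algorithm $\mathcal{A}$ there exist a dimension $d\le C\sqrt{\kappa/n}\,\log(\Delta/\varepsilon)$ and $n$ functions $f_1,\dots,f_n:\mathbb{R}^d\to\mathbb{R}$, each $L$-smooth and $\mu$-strongly convex, such that $f=\frac1n\sum_{i=1}^n f_i$ satisfies $f(x_0)-f(x^* )=\Delta$ (where $x^*$ is the minimizer of $f$ and $x_0$ the initial point of $\mathcal{A}$), and the iterates of $\mathcal{A}$ run on $f_1,\dots,f_n$ satisfy $\mathbb{E} f(x_t)-f(x^* )\ge\varepsilon$ for all integers $0\le t\le c\,(n+\sqrt{\kappa n})\log(\Delta/\varepsilon)$. In other words, $\mathcal{A}$ needs $\Omega\big((n+\sqrt{\kappa n})\log(\Delta/\varepsilon)\big)$ oracle queries to find $\hat x$ with $\mathbb{E} f(\hat x)-f(x^* )<\varepsilon$.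
   Context: A differentiable $g:\mathbb{R}^d\to\mathbb{R}$ is $L$-smooth if $\|\nabla g(x)-\nabla g(y)\|_2\le L\|x-y\|_2$ for all $x,y$, and $\mu$-strongly convex if $g(y)\ge g(x)+\langle\nabla g(x),y-x\rangle+\frac{\mu}{2}\|y-x\|_2^2$ for all $x,y$. For $\gamma>0$, $\mathrm{prox}^{\gamma}_g(x)=\arg\min_u\{g(u)+\frac{1}{2\gamma}\|x-u\|_2^2\}$. PIFO algorithm: given $f_1,\dots,f_n:\mathbb{R}^d\to\mathbb{R}$ and $f=\frac1n\sum_i f_i$, a PIFO algorithm $\mathcal{A}$ is specified by a probability vector $(p_1,\dots,p_n)$ ($p_j\ge0$, $\sum_j p_j=1$), an initial point $x_0$ and parameters $\gamma_t>0$; it draws indices $i_1,i_2,\dots$ independently with $\mathbb{P}(i_t=j)=p_j$, at step $t\ge1$ queries the oracle $h_f(x_{t-1},i_t,\gamma_t)=[f_{i_t}(x_{t-1}),\nabla f_{i_t}(x_{t-1}),\mathrm{prox}^{\gamma_t}_{f_{i_t}}(x_{t-1})]$, and outputs an iterate $x_t\in\mathrm{span}\{x_0,\dots,x_{t-1},\nabla f_{i_1}(x_0),\dots,\nabla f_{i_t}(x_{t-1}),\mathrm{prox}^{\gamma_1}_{f_{i_1}}(x_0),\dots,\mathrm{prox}^{\gamma_t}_{f_{i_t}}(x_{t-1})\}$ (the choice within the span may depend on all previously observed information). Iterate $x_t$ uses $t$ oracle queries. *)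

(* Defs.v *)
From Stdlib Require Import Reals List.
From Stdlib Require Fin.
Import ListNotations.
Open Scope R_scope.

Fixpoint fsum (d : nat) : (Fin.t d -> R) -> R :=
  match d return (Fin.t d -> R) -> R with
  | O => fun _ => 0
  | S d' => fun f => f Fin.F1 + fsum d' (fun i => f (Fin.FS i))
  end.

Definition Vec (d : nat) : Type := Fin.t d -> R.

Definition vzero {d} : Vec d := fun _ => 0.
Definition vadd {d} (x y : Vec d) : Vec d := fun i => x i + y i.
Definition vsub {d} (x y : Vec d) : Vec d := fun i => x i - y i.
Definition vscale {d} (a : R) (x : Vec d) : Vec d := fun i => a * x i.

Definition dot {d} (x y : Vec d) : R := fsum d (fun i => x i * y i).
Definition sqnorm {d} (x : Vec d) : R := dot x x.
Definition norm {d} (x : Vec d) : R := sqrt (sqnorm x).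

Definition has_gradient {d} (g : Vec d -> R) (x v : Vec d) : Prop :=
  forall eps, 0 < eps -> exists delta, 0 < delta /\
    forall y, norm (vsub y x) < delta ->
      Rabs (g y - g x - dot v (vsub y x)) <= eps * norm (vsub y x).

Definition is_gradient {d} (g : Vec d -> R) (gg : Vec d -> Vec d) : Prop :=
  forall x, has_gradient g x (gg x).

(* L-smoothness of g, whose gradient is gg *)
Definition L_smooth {d} (L : R) (gg : Vec d -> Vec d) : Prop :=
  forall x y, norm (vsub (gg x) (gg y)) <= L * norm (vsub x y).

Definition strongly_convex {d} (mu : R) (g : Vec d -> R) (gg : Vec d -> Vec d) : Prop :=
  forall x y, g y >= g x + dot (gg x) (vsub y x) + mu / 2 * sqnorm (vsub y x).

Definition is_prox {d} (g : Vec d -> R) (gamma : R) (x u : Vec d) : Prop :=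
  forall v, g u + / (2 * gamma) * sqnorm (vsub x u)
            <= g v + / (2 * gamma) * sqnorm (vsub x v).

Fixpoint lincomb {d} (cs : list R) (vs : list (Vec d)) : Vec d :=
  match cs, vs with
  | c :: cs', v :: vs' => vadd (vscale c v) (lincomb cs' vs')
  | _, _ => vzero
  end.

Definition in_span {d} (vs : list (Vec d)) (v : Vec d) : Prop :=
  exists cs, v = lincomb cs vs.

(* One oracle round: query point x_{t-1}, drawn index i_t, and the answer
   [f_{i_t}(x_{t-1}), grad f_{i_t}(x_{t-1}), prox^{gamma_t}_{f_{i_t}}(x_{t-1})]. *)
Record obs (n d : nat) := Obs {
  o_pt : Vec d;
  o_idx : Fin.t n;
  o_val : R;
  o_grad : Vec d;
  o_prox : Vec d }.
Arguments o_pt {n d}.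
Arguments o_idx {n d}.
Arguments o_val {n d}.
Arguments o_grad {n d}.
Arguments o_prox {n d}.
Arguments Obs {n d}.

(* A PIFO algorithm for n component functions (indices Fin.t n): sampling
   distribution p, proximal parameters gamma_t (t >= 1), initial point in
   every dimension d, and an update rule choosing x_t from the whole observed
   history (all previous queries and oracle answers). *)
Record PIFO (n : nat) := MkPIFO {
  pifo_p : Fin.t n -> R;
  pifo_gamma : nat -> R;
  pifo_x0 : forall d, Vec d;
  pifo_step : forall d, list (obs n d) -> Vec d }.
Arguments pifo_p {n}.
Arguments pifo_gamma {n}.
Arguments pifo_x0 {n}.
Arguments pifo_step {n}.

Definition hist_vectors {n d} (x0 : Vec d) (h : list (obs n d)) : list (Vec d) :=
  x0 :: flat_map (fun o => [o_pt o; o_grad o; o_prox o]) h.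

Definition is_PIFO {n} (A : PIFO n) : Prop :=
  (forall j, 0 <= pifo_p A j) /\ fsum n (pifo_p A) = 1 /\
  (forall t, (1 <= t)%nat -> 0 < pifo_gamma A t) /\
  (forall d (h : list (obs n d)), h <> [] ->
     in_span (hist_vectors (pifo_x0 A d) h) (pifo_step A d h)).

Definition cur_iterate {n d} (A : PIFO n) (h : list (obs n d)) : Vec d :=
  match h with
  | [] => pifo_x0 A d
  | _ => pifo_step A d h
  end.

Fixpoint run {n d} (A : PIFO n) (fs : Fin.t n -> Vec d -> R)
    (gfs : Fin.t n -> Vec d -> Vec d) (prx : Fin.t n -> R -> Vec d -> Vec d)
    (h : list (obs n d)) (s : list (Fin.t n)) : list (obs n d) :=
  match s with
  | [] => h
  | j :: s' =>
      let x := cur_iterate A h in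
      let g := pifo_gamma A (S (length h)) in
      run A fs gfs prx (h ++ [Obs x j (fs j x) (gfs j x) (prx j g x)]) s'
  end.

Definition iterate {n d} (A : PIFO n) fs gfs prx (s : list (Fin.t n)) : Vec d :=
  cur_iterate A (@run n d A fs gfs prx [] s).

(* Expectation over i_1, ..., i_t drawn i.i.d. from p of F(i_1, ..., i_t) *)
Fixpoint expect {n} (p : Fin.t n -> R) (t : nat) (F : list (Fin.t n) -> R) : R :=
  match t with
  | O => F []
  | S t' => fsum n (fun j => p j * expect p t' (fun s => F (j :: s)))
  end.

Definition favg {n d} (fs : Fin.t n -> Vec d -> R) (x : Vec d) : R :=
  / INR n * fsum n (fun j => fs j x).

(* Main.v *)
Require Import Defs.
From Stdlib Require Import Reals ZArith List Lra Lia Permutation FunctionalExtensionality.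
From Stdlib Require Fin.
Import ListNotations.
Open Scope R_scope.

(** Pick two indices [a <> b] that are drawn with probability at most [2 / n].  Component [a] carries
the links [y_k - y_(k+1)] of a chain with [k] even together with the linear term driving [y_1],
component [b] the links with [k] odd, and all other components are [mu / 2 * |y|^2].  The links
inside one component are disjoint, so its Hessian is [mu] plus a matching Laplacian: it is
[L]-smooth, and a gradient or a prox extends the support of a point by at most one coordinate, and
only if the component holding the next link is drawn.  The average has condition number of order
[kappa / n], and its minimizer is exactly geometric, [y*_k = B * r^k] with
[1 - r] of order [sqrt (n / kappa)].  Hence a point supported on the first [k] coordinates has gap
at least [Delta / 2 * (r^(2k) - r^(2m))], and the expectation of [r^(2k)] shrinks at most by the factor
[1 - 2 / n * (1 - r^2)] per query.

The span always contains [x0], so coordinate 0 is reserved for the direction of [x0], by means of a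
Householder reflection; the chain lives on the coordinates [1, ..., m]. *)

(** * Finite sums and inner products *)

Lemma fsum_ext d (f g : Fin.t d -> R) : (forall i, f i = g i) -> fsum d f = fsum d g.
Proof.
  intros E; induction d as [|d IH]; simpl; [reflexivity|].
  rewrite E; f_equal; apply IH; intros i; apply E.
Qed.

Lemma fsum_le d (f g : Fin.t d -> R) : (forall i, f i <= g i) -> fsum d f <= fsum d g.
Proof.
  intros E; induction d as [|d IH]; simpl; [lra|].
  apply Rplus_le_compat; [apply E|apply IH; intros i; apply E].
Qed.

Lemma fsum_plus d (f g : Fin.t d -> R) : fsum d (fun i => f i + g i) = fsum d f + fsum d g.
Proof. induction d as [|d IH]; simpl; [lra|]. rewrite IH; lra. Qed.

Lemma fsum_scal d a (f : Fin.t d -> R) : fsum d (fun i => a * f i) = a * fsum d f.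
Proof. induction d as [|d IH]; simpl; [lra|]. rewrite IH; lra. Qed.

Lemma fsum_const d a : fsum d (fun _ => a) = INR d * a.
Proof.
  induction d as [|d IH]; [simpl; lra|].
  rewrite S_INR; simpl fsum; rewrite IH; lra.
Qed.

Lemma fsum_minus d (f g : Fin.t d -> R) : fsum d (fun i => f i - g i) = fsum d f - fsum d g.
Proof. induction d as [|d IH]; simpl; [lra|]. rewrite IH; lra. Qed.

Lemma fsum_indicator d (a : Fin.t d) c :
  fsum d (fun i => if Fin.eq_dec i a then c else 0) = c.
Proof.
  induction a as [d|d a IH]; cbn [fsum].
  - destruct (Fin.eq_dec Fin.F1 Fin.F1) as [_|H]; [|easy].
    rewrite (fsum_ext _ _ (fun _ => 0)).
    + rewrite fsum_const; lra.
    + intros i; destruct (Fin.eq_dec (Fin.FS i) Fin.F1) as [H|_]; [inversion H|reflexivity].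
  - destruct (Fin.eq_dec Fin.F1 (Fin.FS a)) as [H|_]; [inversion H|].
    rewrite (fsum_ext _ _ (fun i => if Fin.eq_dec i a then c else 0)).
    + rewrite IH; lra.
    + intros i; destruct (Fin.eq_dec (Fin.FS i) (Fin.FS a)) as [H|H];
        destruct (Fin.eq_dec i a) as [H'|H']; try reflexivity.
      * apply Fin.FS_inj in H; contradiction.
      * subst; contradiction.
Qed.

Lemma fsum_exchange n d (f : Fin.t n -> Fin.t d -> R) :
  fsum n (fun i => fsum d (fun j => f i j)) = fsum d (fun j => fsum n (fun i => f i j)).
Proof.
  induction n as [|n IH]; simpl.
  - rewrite fsum_const; lra.
  - rewrite IH, fsum_plus; reflexivity.
Qed.

Lemma dot_comm d (x y : Vec d) : dot x y = dot y x.
Proof. apply fsum_ext; intros i; ring. Qed.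

Lemma dot_add_r d (x y z : Vec d) : dot x (vadd y z) = dot x y + dot x z.
Proof.
  unfold dot; rewrite <- fsum_plus; apply fsum_ext; intros i; unfold vadd; ring.
Qed.

Lemma dot_scale_r d a (x y : Vec d) : dot x (vscale a y) = a * dot x y.
Proof.
  unfold dot; rewrite <- fsum_scal; apply fsum_ext; intros i; unfold vscale; ring.
Qed.

Lemma dot_sub_r d (x y z : Vec d) : dot x (vsub y z) = dot x y - dot x z.
Proof.
  unfold dot; rewrite <- fsum_minus; apply fsum_ext; intros i; unfold vsub; ring.
Qed.

Lemma dot_add_l d (x y z : Vec d) : dot (vadd y z) x = dot y x + dot z x.
Proof. rewrite !(dot_comm _ _ x); apply dot_add_r. Qed.

Lemma dot_scale_l d a (x y : Vec d) : dot (vscale a y) x = a * dot y x.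
Proof. rewrite !(dot_comm _ _ x); apply dot_scale_r. Qed.

Lemma dot_sub_l d (x y z : Vec d) : dot (vsub y z) x = dot y x - dot z x.
Proof. rewrite !(dot_comm _ _ x); apply dot_sub_r. Qed.

Lemma sqnorm_ge0 d (x : Vec d) : 0 <= sqnorm x.
Proof.
  unfold sqnorm, dot; rewrite <- (Rmult_0_r (INR d)), <- fsum_const.
  apply fsum_le; intros i; nra.
Qed.

Lemma norm_ge0 d (x : Vec d) : 0 <= norm x.
Proof. apply sqrt_pos. Qed.

Lemma norm_sqr d (x : Vec d) : norm x * norm x = sqnorm x.
Proof. apply sqrt_sqrt, sqnorm_ge0. Qed.

Lemma sqnorm_eq0 d (x : Vec d) : sqnorm x = 0 -> forall i, x i = 0.
Proof.
  unfold sqnorm, dot; intros H i; revert x H; induction i as [d|d i IH]; intros x H; simpl in H.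
  - pose proof (sqnorm_ge0 _ (fun j => x (Fin.FS j))) as P; unfold sqnorm, dot in P; nra.
  - apply (IH (fun j => x (Fin.FS j))).
    pose proof (sqnorm_ge0 _ (fun j => x (Fin.FS j))) as P; unfold sqnorm, dot in P; nra.
Qed.

(** * Coordinates indexed by natural numbers *)

Fixpoint fidx {d} (i : Fin.t d) : nat :=
  match i with Fin.F1 => O | Fin.FS i' => S (fidx i') end.

(* Zero for [k >= d]. *)
Fixpoint coord {d} : Vec d -> nat -> R :=
  match d return Vec d -> nat -> R with
  | O => fun _ _ => 0
  | S d' => fun y k =>
      match k with O => y Fin.F1 | S k' => @coord d' (fun i => y (Fin.FS i)) k' end
  end.

Lemma fidx_lt d (i : Fin.t d) : (fidx i < d)%nat.
Proof. induction i; simpl; lia. Qed.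

Lemma coord_fidx d (y : Vec d) i : coord y (fidx i) = y i.
Proof. induction i as [d|d i IH]; simpl; [reflexivity|apply (IH (fun j => y (Fin.FS j)))]. Qed.

Lemma coord_mk d (h : nat -> R) k : (k < d)%nat -> coord (fun i : Fin.t d => h (fidx i)) k = h k.
Proof.
  revert h k; induction d as [|d IH]; intros h k Hk; [lia|].
  destruct k as [|k]; simpl; [reflexivity|].
  apply (IH (fun j => h (S j))); lia.
Qed.

Lemma coord_out d (y : Vec d) k : (d <= k)%nat -> coord y k = 0.
Proof.
  revert y k; induction d as [|d IH]; intros y k Hk; [reflexivity|].
  destruct k as [|k]; [lia|]; simpl; apply IH; lia.
Qed.

(** Over the list [seq 0 d], reindexing becomes a matter of [Permutation]. *)
Lemma fsum_seq d (f : nat -> R) :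
  fsum d (fun i => f (fidx i)) = fold_right Rplus 0 (map f (seq 0 d)).
Proof.
  revert f; induction d as [|d IH]; intros f; simpl; [reflexivity|].
  f_equal; rewrite <- seq_shift, map_map; apply (IH (fun j => f (S j))).
Qed.

Lemma fold_Rplus_perm l l' : Permutation l l' -> fold_right Rplus 0 l = fold_right Rplus 0 l'.
Proof. induction 1; simpl; lra. Qed.

Definition involution_on (d : nat) (pi : nat -> nat) : Prop :=
  forall k, (k < d)%nat -> (pi k < d)%nat /\ pi (pi k) = k.

Lemma fsum_involution d pi (f : nat -> R) : involution_on d pi ->
  fsum d (fun i => f (pi (fidx i))) = fsum d (fun i => f (fidx i)).
Proof.
  intros Hpi.
  rewrite (fsum_seq d f), (fsum_seq d (fun k => f (pi k))), <- (map_map pi f).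
  apply fold_Rplus_perm, Permutation_map, NoDup_Permutation.
  - apply NoDup_map_NoDup_ForallPairs; [|apply seq_NoDup].
    intros a b Ha Hb E; apply in_seq in Ha, Hb.
    rewrite <- (proj2 (Hpi a ltac:(lia))), <- (proj2 (Hpi b ltac:(lia))), E; reflexivity.
  - apply seq_NoDup.
  - intros x; rewrite in_map_iff, in_seq; split.
    + intros (y & <- & Hy); apply in_seq in Hy; specialize (Hpi y); lia.
    + intros Hx; exists (pi x); rewrite in_seq; specialize (Hpi x); lia.
Qed.

Lemma fidx_surj d k : (k < d)%nat -> exists i : Fin.t d, fidx i = k.
Proof.
  revert k; induction d as [|d IH]; intros k Hk; [lia|].
  destruct k as [|k]; [exists Fin.F1; reflexivity|].
  destruct (IH k ltac:(lia)) as [i <-]; exists (Fin.FS i); reflexivity.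
Qed.

(** Coordinate 0 is always free: [supp 0] is the line reserved for the start, and [supp k] adds the
    first [k] chain coordinates. *)
Definition supp {d} (k : nat) (y : Vec d) : Prop := forall i, (k < fidx i)%nat -> y i = 0.

Lemma supp_coord d k (y : Vec d) j : supp k y -> (k < j)%nat -> coord y j = 0.
Proof.
  intros H Hj; destruct (Nat.lt_ge_cases j d) as [Hd|Hd]; [|apply coord_out, Hd].
  destruct (fidx_surj d j Hd) as [i <-]; rewrite coord_fidx; apply H, Hj.
Qed.

Lemma supp_le d k k' (y : Vec d) : (k <= k')%nat -> supp k y -> supp k' y.
Proof. intros Hk H i Hi; apply H; lia. Qed.
(** * Quadratic functions *)

(** This one predicate encodes a symmetric matrix: since [dot] is nondegenerate, self-adjointness
    forces linearity, which the lemmas after [dot_inj] extract. *)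
Definition symmetric {d} (M : Vec d -> Vec d) : Prop :=
  forall x y, dot (M x) y = dot x (M y).

Lemma dot_inj d (x y : Vec d) : (forall h, dot x h = dot y h) -> x = y.
Proof.
  intros E; apply functional_extensionality; intros i.
  assert (H : sqnorm (vsub x y) = 0) by (unfold sqnorm; rewrite dot_sub_l, E; lra).
  pose proof (sqnorm_eq0 _ _ H i) as Hi; unfold vsub in Hi; lra.
Qed.

Lemma symmetric_sub d (M : Vec d -> Vec d) : symmetric M ->
  forall x y, M (vsub x y) = vsub (M x) (M y).
Proof. intros Ms x y; apply dot_inj; intros h; rewrite Ms, !dot_sub_l, !Ms; reflexivity. Qed.

Lemma symmetric_add d (M : Vec d -> Vec d) : symmetric M ->
  forall x y, M (vadd x y) = vadd (M x) (M y).
Proof. intros Ms x y; apply dot_inj; intros h; rewrite Ms, !dot_add_l, !Ms; reflexivity. Qed.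

Lemma symmetric_scale d (M : Vec d -> Vec d) : symmetric M ->
  forall a x, M (vscale a x) = vscale a (M x).
Proof. intros Ms a x; apply dot_inj; intros h; rewrite Ms, !dot_scale_l, !Ms; reflexivity. Qed.

Definition quad {d} (M : Vec d -> Vec d) (b x : Vec d) : R := / 2 * dot x (M x) - dot b x.

Definition quad_grad {d} (M : Vec d -> Vec d) (b x : Vec d) : Vec d := vsub (M x) b.

Lemma quad_expand d (M : Vec d -> Vec d) b : symmetric M ->
  forall x y, quad M b y = quad M b x + dot (quad_grad M b x) (vsub y x)
              + / 2 * dot (vsub y x) (M (vsub y x)).
Proof.
  intros Msym x y; unfold quad, quad_grad.
  rewrite (symmetric_sub _ _ Msym), !dot_sub_l, !dot_sub_r, (Msym x y), (Msym x x).
  rewrite (dot_comm _ y (M x)), (Msym x y); lra.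
Qed.

Lemma quad_is_gradient d (M : Vec d -> Vec d) b L :
  symmetric M -> 0 < L ->
  (forall h, 0 <= dot h (M h) <= L * sqnorm h) ->
  is_gradient (quad M b) (quad_grad M b).
Proof.
  intros Msym HL Hb x e He.
  exists (e / L); split; [apply Rdiv_lt_0_compat; lra|].
  intros y Hy; rewrite (quad_expand d M b Msym x y).
  replace (_ - _ - _) with (/ 2 * dot (vsub y x) (M (vsub y x))) by ring.
  destruct (Hb (vsub y x)) as [H0 H1]; rewrite <- norm_sqr in H1.
  pose proof (norm_ge0 _ (vsub y x)) as Hn.
  rewrite Rabs_pos_eq by lra.
  assert (L * norm (vsub y x) < e).
  { apply (Rmult_lt_compat_l L) in Hy; [|lra].
    replace (L * (e / L)) with e in Hy by (field; lra); lra. }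
  nra.
Qed.

Lemma quad_L_smooth d (M : Vec d -> Vec d) b L :
  symmetric M -> 0 < L -> (forall h, sqnorm (M h) <= L * L * sqnorm h) ->
  L_smooth L (quad_grad M b).
Proof.
  intros Msym HL HM x y.
  replace (vsub (quad_grad M b x) (quad_grad M b y)) with (M (vsub x y)).
  - unfold norm at 1; rewrite <- (sqrt_Rsqr (L * norm (vsub x y))).
    + apply sqrt_le_1_alt; unfold Rsqr; specialize (HM (vsub x y)).
      rewrite <- norm_sqr in HM; rewrite <- norm_sqr; rewrite <- norm_sqr in HM; lra.
    + pose proof (norm_ge0 _ (vsub x y)); nra.
  - rewrite (symmetric_sub _ _ Msym); apply functional_extensionality; intros i.
    unfold quad_grad, vsub; ring.
Qed.

Lemma quad_strongly_convex d (M : Vec d -> Vec d) b mu :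
  symmetric M -> (forall h, mu * sqnorm h <= dot h (M h)) ->
  strongly_convex mu (quad M b) (quad_grad M b).
Proof.
  intros Msym HM x y; rewrite (quad_expand d M b Msym x y).
  specialize (HM (vsub y x)); lra.
Qed.

(** The condition on [u] is stationarity of the prox objective. Expanding about [u], the linear
    terms cancel and a nonnegative form in [v - u] remains. *)
Lemma quad_is_prox d (M : Vec d -> Vec d) b gamma x u :
  symmetric M -> (forall h, 0 <= dot h (M h)) -> 0 < gamma ->
  (forall i, quad_grad M b u i + / gamma * (u i - x i) = 0) ->
  is_prox (quad M b) gamma x u.
Proof.
  intros Msym HM Hg Hu v; rewrite (quad_expand d M b Msym u v).
  assert (E : dot (quad_grad M b u) (vsub v u) = / gamma * dot (vsub x u) (vsub v u)).
  { rewrite <- dot_scale_l; apply fsum_ext; intros i; specialize (Hu i).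
    unfold vscale, vsub at 2; f_equal; lra. }
  assert (E' : sqnorm (vsub x v) = sqnorm (vsub x u) - 2 * dot (vsub x u) (vsub v u)
               + sqnorm (vsub v u)).
  { unfold sqnorm; rewrite !dot_sub_l, !dot_sub_r, (dot_comm _ v x), (dot_comm _ u x),
      (dot_comm _ v u); lra. }
  rewrite E, E', Rinv_mult.
  pose proof (HM (vsub v u)); pose proof (sqnorm_ge0 _ (vsub v u)).
  pose proof (Rinv_0_lt_compat _ Hg); nra.
Qed.

(** * Conjugation by a reflection *)

Lemma exists_reflection d (x0 : Vec (S d)) : exists (z : R) (H : Vec (S d) -> Vec (S d)),
  symmetric H /\ (forall x, H (H x) = x) /\
  H x0 = (fun i => if Nat.eqb (fidx i) 0 then z else 0).
Proof.
  set (z := norm x0).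
  set (e := (fun i => if Nat.eqb (fidx i) 0 then 1 else 0) : Vec (S d)).
  set (v := vsub x0 (vscale z e)).
  (* Householder; also correct for [v = 0], whatever the value of [/ 0]. *)
  exists z, (fun x => vsub x (vscale (2 * dot v x / dot v v) v)).
  assert (Hv0 : dot v v = 0 -> forall i, v i = 0) by exact (sqnorm_eq0 _ v).
  repeat split.
  - intros x y; rewrite dot_sub_l, dot_sub_r, dot_scale_l, dot_scale_r.
    rewrite (dot_comm _ x v); unfold Rdiv; ring.
  - intros x; apply functional_extensionality; intros i.
    rewrite dot_sub_r, dot_scale_r; unfold vsub, vscale.
    destruct (Req_dec (dot v v) 0) as [E|E]; [|field; exact E].
    rewrite (Hv0 E i); ring.
  - assert (He : dot e e = 1).
    { unfold dot, e; simpl.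
      rewrite (fsum_ext _ _ (fun _ => 0)); [rewrite fsum_const; lra|intros i; ring]. }
    assert (Hz : z * z = dot x0 x0) by apply norm_sqr.
    apply functional_extensionality; intros i.
    assert (Hi : (if Nat.eqb (fidx i) 0 then z else 0) = z * e i)
      by (unfold e; destruct (Nat.eqb _ _); ring).
    rewrite Hi.
    destruct (Req_dec (dot v v) 0) as [E|E].
    + unfold vsub at 1, vscale at 1; rewrite (Hv0 E i).
      pose proof (Hv0 E i) as Hvi; unfold v, vsub, vscale in Hvi; lra.
    (* As [x0] and [z * e] have equal norms, the coefficient of the reflection at [x0] is exactly 1,
       so [x0] goes to [x0 - v = z * e]. *)
    + assert (Ev : 2 * dot v x0 = dot v v).
      { unfold v; rewrite !dot_sub_l, !dot_sub_r, !dot_scale_l, !dot_scale_r, He, <- Hz.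
        rewrite (dot_comm _ x0 e); ring. }
      rewrite Ev; unfold Rdiv; rewrite Rinv_r by exact E.
      unfold v, vsub, vscale; ring.
Qed.

Definition conjugate {d} (H M : Vec d -> Vec d) (x : Vec d) : Vec d := H (M (H x)).

Lemma reflection_dot d (H : Vec d -> Vec d) : symmetric H -> (forall x, H (H x) = x) ->
  forall x y, dot (H x) (H y) = dot x y.
Proof. intros Hs Hi x y; rewrite Hs, Hi; reflexivity. Qed.

Lemma conjugate_symmetric d (H M : Vec d -> Vec d) : symmetric H -> symmetric M -> symmetric (conjugate H M).
Proof. intros Hs Ms x y; unfold conjugate; rewrite Hs, Ms, Hs; reflexivity. Qed.


(** * Operators attached to weighted involutions *)

Definition wswap {d} (sg : nat -> R) (pi : nat -> nat) (y : Vec d) : Vec d :=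
  fun i => sg (fidx i) * coord y (pi (fidx i)).

(** The matrix [mu + w (I - S)] with [S] a weighted permutation. A two-point orbit of weight 1 gives
    [w] times the Laplacian of a link; a fixed point gives the diagonal term [w * (1 - sg)]. *)
Definition wop {d} (mu w : R) (sg : nat -> R) (pi : nat -> nat) (y : Vec d) : Vec d :=
  fun i => mu * y i + w * (y i - wswap sg pi y i).

Definition weighted_involution (d : nat) (sg : nat -> R) (pi : nat -> nat) : Prop :=
  involution_on d pi /\ (forall k, (k < d)%nat -> sg (pi k) = sg k) /\ (forall k, 0 <= sg k <= 1).

Lemma wswap_symmetric d sg pi : weighted_involution d sg pi -> symmetric (@wswap d sg pi).
Proof.
  intros (Hpi & Hsg & _) x y; unfold dot, wswap.
  rewrite (fsum_ext _ _ (fun i => sg (fidx i) * coord x (pi (fidx i)) * coord y (fidx i)))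
    by (intros i; rewrite (coord_fidx _ y); reflexivity).
  rewrite <- (fsum_involution d pi (fun k => sg k * coord x (pi k) * coord y k) Hpi).
  apply fsum_ext; intros i; destruct (Hpi _ (fidx_lt _ i)) as [_ E].
  rewrite E, (Hsg _ (fidx_lt _ i)), coord_fidx; ring.
Qed.

Lemma wop_symmetric d mu w sg pi : weighted_involution d sg pi -> symmetric (@wop d mu w sg pi).
Proof.
  intros Hs x y; pose proof (wswap_symmetric d sg pi Hs x y) as E.
  assert (D : forall u : Vec d, wop mu w sg pi u = vadd (vscale mu u) (vscale w (vsub u (wswap sg pi u))))
    by reflexivity.
  rewrite !D, dot_add_l, dot_add_r, !dot_scale_l, !dot_scale_r, dot_sub_l, dot_sub_r, E.
  reflexivity.
Qed.

Lemma fsum_sqr_involution d pi (h : Vec d) : involution_on d pi ->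
  fsum d (fun i => coord h (pi (fidx i)) * coord h (pi (fidx i))) = sqnorm h.
Proof.
  intros Hpi; rewrite (fsum_involution d pi (fun k => coord h k * coord h k) Hpi).
  apply fsum_ext; intros i; rewrite coord_fidx; reflexivity.
Qed.

(** [S] has norm at most 1, so the spectrum of [mu + w (I - S)] lies in [[mu, mu + 2 w]]. *)
Lemma wop_bounds d mu w sg pi (h : Vec d) : weighted_involution d sg pi -> 0 < mu -> 0 <= w ->
  mu * sqnorm h <= dot h (wop mu w sg pi h) <= (mu + 2 * w) * sqnorm h /\
  sqnorm (wop mu w sg pi h) <= (mu + 2 * w) * (mu + 2 * w) * sqnorm h.
Proof.
  intros (Hpi & _ & Hsg) Hmu Hw.
  pose proof (fsum_sqr_involution d pi h Hpi) as Esq.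
  (* As [pi] permutes the coordinates, a multiple of [sqnorm h] can be shared between the entries at
     [i] and [pi i]; each bound then holds term by term. *)
  assert (Key : forall a b, a * sqnorm h + b * sqnorm h =
    fsum d (fun i => a * (h i * h i) + b * (coord h (pi (fidx i)) * coord h (pi (fidx i))))).
  { intros a b; rewrite fsum_plus, !fsum_scal, Esq; reflexivity. }
  assert (Amgm : forall s x y, 0 <= s <= 1 ->
    - (x * x + y * y) <= 2 * s * x * y <= x * x + y * y).
  { intros s x y Hs; pose proof (Rle_0_sqr (x - y)); pose proof (Rle_0_sqr (x + y)).
    unfold Rsqr in *; split; nra. }
  repeat split.
  - replace (mu * sqnorm h) with ((mu + w / 2) * sqnorm h + (- (w / 2)) * sqnorm h) by field.
    rewrite Key; apply fsum_le; intros i; unfold wop, wswap.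
    specialize (Amgm (sg (fidx i)) (h i) (coord h (pi (fidx i))) (Hsg _)); nra.
  - replace ((mu + 2 * w) * sqnorm h) with ((mu + 3 * w / 2) * sqnorm h + (w / 2) * sqnorm h)
      by field.
    rewrite Key; apply fsum_le; intros i; unfold wop, wswap.
    specialize (Amgm (sg (fidx i)) (h i) (coord h (pi (fidx i))) (Hsg _)); nra.
  - replace ((mu + 2 * w) * (mu + 2 * w) * sqnorm h)
      with (((mu + w) * (mu + 2 * w)) * sqnorm h + (w * (mu + 2 * w)) * sqnorm h) by ring.
    rewrite Key; apply fsum_le; intros i; unfold wop, wswap.
    specialize (Amgm (sg (fidx i)) (h i) (coord h (pi (fidx i))) (Hsg _)).
    specialize (Hsg (fidx i)); set (s := sg (fidx i)) in *.
    set (x := h i) in *; set (y := coord h (pi (fidx i))) in *.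
    assert (A : w * (mu + w) * - (2 * s * x * y) <= w * (mu + w) * (x * x + y * y))
      by (apply Rmult_le_compat_l; [nra|lra]).
    assert (B : w * w * (s * s * (y * y)) <= w * w * (y * y)).
    { apply Rmult_le_compat_l; [nra|]. pose proof (Rle_0_sqr y); unfold Rsqr in *.
      assert (s * s <= 1) by nra. nra. }
    lra.
Qed.

(* On each orbit [{j, pi j}] the system [wop u + u / gamma = q] is two-dimensional, and
   [c - w S] is inverted by [(c + w S) / (c^2 - w^2 S^2)]. *)
Definition wop_prox {d} (mu w : R) sg pi (b : Vec d) (gamma : R) (x : Vec d) : Vec d :=
  let q := vadd b (vscale (/ gamma) x) in
  let c := mu + w + / gamma in
  fun i => (c * q i + w * wswap sg pi q i) / (c * c - w * sg (fidx i) * (w * sg (fidx i))).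

Lemma wop_prox_spec d mu w sg pi (b : Vec d) gamma x i :
  weighted_involution d sg pi -> 0 < mu -> 0 <= w -> 0 < gamma ->
  quad_grad (wop mu w sg pi) b (wop_prox mu w sg pi b gamma x) i
  + / gamma * (wop_prox mu w sg pi b gamma x i - x i) = 0.
Proof.
  intros (Hpi & Hsg & Hb) Hmu Hw Hg.
  set (u := wop_prox mu w sg pi b gamma x).
  set (q := vadd b (vscale (/ gamma) x)).
  set (c := mu + w + / gamma).
  destruct (Hpi _ (fidx_lt _ i)) as [Hlt Hinv].
  assert (Eu : forall k, (k < d)%nat -> coord u k =
    (c * coord q k + w * (sg k * coord q (pi k))) / (c * c - w * sg k * (w * sg k))).
  { intros k Hk; destruct (fidx_surj d k Hk) as [j <-]; rewrite !coord_fidx; reflexivity. }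
  assert (Hqi : q i = b i + / gamma * x i) by reflexivity.
  unfold quad_grad, vsub at 1, wop, wswap.
  rewrite <- (coord_fidx _ u i), (Eu _ (fidx_lt _ i)), (Eu _ Hlt), Hinv,
    (Hsg _ (fidx_lt _ i)), coord_fidx.
  specialize (Hb (fidx i)); set (s := sg (fidx i)) in *.
  set (q' := coord q (pi (fidx i))).
  pose proof (Rinv_0_lt_compat _ Hg) as Hg'.
  assert (Hc : c * c - w * s * (w * s) > 0).
  { assert (w * s <= w) by nra. assert (0 <= w * s) by nra. assert (w < c) by (unfold c; lra). nra. }
  replace (b i) with (q i - / gamma * x i) by lra.
  set (g := / gamma) in *.
  (* The entries of [u] at [i] and at its partner share a denominator because [sg] agrees there.
     Clearing it leaves a two-by-two inversion. *)
  transitivity (c * ((c * q i + w * (s * q')) / (c * c - w * s * (w * s)))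
    - w * s * ((c * q' + w * (s * q i)) / (c * c - w * s * (w * s))) - q i);
    [unfold c; ring | field; lra].
Qed.

(** * The chain *)

(* [Some true] is component [a] (links [j -- j+1], [j] even), [Some false] is component [b] (odd
   [j]), and [None] is any other component. *)
Definition partner (m : nat) (o : option bool) (j : nat) : nat :=
  match o with
  | None => j
  | Some e =>
      if Nat.eqb j 0 then 0%nat
      else if Bool.eqb (Nat.even j) e then (if Nat.ltb j m then S j else j)
      else (if Nat.eqb j 1 then 1%nat else pred j)
  end.

(** In the component that would carry the link from [m] to [m + 1], the end [m] is a fixed point;
    weight [r] leaves the diagonal term [w * (1 - r)] there. *)
Definition weight (m : nat) (r : R) (o : option bool) (j : nat) : R :=
  match o with
  | None => 1
  | Some e => if (Nat.eqb j m && Bool.eqb (Nat.even m) e)%bool then r else 1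
  end.

Definition drive (o : option bool) : R := match o with Some true => 1 | _ => 0 end.

(** Entry [mu * z] centers coordinate 0 at the value [z] of the start, so that coordinate adds
    nothing to the gap. *)
Definition source (mu z lin : R) (o : option bool) (j : nat) : R :=
  match j with O => mu * z | 1%nat => drive o * lin | _ => 0 end.

(** Moving to a neighbour flips the parity, so the forward and backward cases undo each other; all
    other coordinates are fixed. *)
Lemma partner_spec m o : (1 <= m)%nat ->
  forall k, (k < S m)%nat -> (partner m o k < S m)%nat /\ partner m o (partner m o k) = k.
Proof.
  intros Hm k Hk; destruct o as [e|]; [|simpl; lia].
  unfold partner.
  destruct (Nat.eqb_spec k 0) as [->|H0]; [simpl; lia|].
  destruct (Bool.eqb (Nat.even k) e) eqn:Ee.
  - destruct (Nat.ltb_spec k m) as [H1|H1].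
    + split; [lia|].
      destruct (Nat.eqb_spec (S k) 0) as [|_]; [lia|].
      assert (E : Bool.eqb (Nat.even (S k)) e = false).
      { rewrite Nat.even_succ, <- Nat.negb_even.
        destruct (Nat.even k), e; simpl in *; congruence. }
      rewrite E; destruct (Nat.eqb_spec (S k) 1); lia.
    + split; [lia|].
      destruct (Nat.eqb_spec k 0); [lia|]; rewrite Ee.
      destruct (Nat.ltb_spec k m); lia.
  - destruct (Nat.eqb_spec k 1) as [->|H1].
    + split; [lia|]. rewrite Nat.eqb_refl; simpl Nat.eqb; cbv iota; rewrite Ee; reflexivity.
    + split; [lia|].
      destruct (Nat.eqb_spec (pred k) 0) as [|_]; [lia|].
      assert (E : Bool.eqb (Nat.even (pred k)) e = true).
      { destruct k as [|k]; [lia|]; simpl pred.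
        rewrite Nat.even_succ, <- Nat.negb_even in Ee.
        destruct (Nat.even k), e; simpl in *; congruence. }
      rewrite E; destruct (Nat.ltb_spec (pred k) m); lia.
Qed.

(** A weight other than 1 sits only at a fixed point of the matching. *)
Lemma weight_partner m r o k : (1 <= m)%nat -> (k < S m)%nat ->
  weight m r o (partner m o k) = weight m r o k.
Proof.
  intros Hm Hk; destruct (partner_spec m o Hm k Hk) as [_ Hinv].
  assert (Hfix : forall j, weight m r o j <> 1 -> partner m o j = j).
  { clear k Hk Hinv; intros j Hj; destruct o as [e|]; [|reflexivity].
    unfold weight, partner in *.
    destruct (Nat.eqb_spec j m) as [Ej|Ej]; simpl andb in Hj; [subst j|contradiction].
    destruct (Nat.eqb_spec m 0) as [|_]; [lia|].
    destruct (Bool.eqb (Nat.even m) e); [|contradiction].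
    rewrite Nat.ltb_irrefl; reflexivity. }
  destruct (Req_dec (weight m r o k) 1) as [E|E].
  - destruct (Req_dec (weight m r o (partner m o k)) 1) as [E'|E']; [congruence|].
    apply Hfix in E'; congruence.
  - rewrite (Hfix k E); reflexivity.
Qed.

Lemma chain_involution m r o : (1 <= m)%nat -> 0 <= r <= 1 ->
  weighted_involution (S m) (weight m r o) (partner m o).
Proof.
  intros Hm Hr; repeat split.
  - apply partner_spec; assumption.
  - apply partner_spec; assumption.
  - intros k Hk; apply weight_partner; assumption.
  - destruct o; simpl; [destruct (andb _ _)|]; lra.
  - destruct o; simpl; [destruct (andb _ _)|]; lra.
Qed.

Definition advances (k : nat) (o : option bool) : bool :=
  match o with Some e => Bool.eqb e (Nat.even k) | None => false end.

Definition progress (k : nat) (o : option bool) : nat := if advances k o then S k else k.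

(** Only the link from [k] to [k + 1] leaves the coordinates up to [k], and only the advancing
    component can hold it. *)
Lemma partner_progress m o k j : (progress k o < j)%nat -> (k < partner m o j)%nat.
Proof.
  unfold progress, advances, partner; destruct o as [e|]; [|lia].
  destruct (Nat.eqb_spec j 0) as [->|H0]; [destruct (Bool.eqb _ _); lia|].
  intros Hj.
  destruct (Bool.eqb (Nat.even j) e) eqn:Ee.
  - destruct (Bool.eqb e _), (Nat.ltb j m); lia.
  - destruct (Nat.eqb_spec j 1) as [->|H1].
    + destruct (Bool.eqb e _); lia.
    + destruct (Bool.eqb e (Nat.even k)) eqn:Ek; [lia|].
      assert (j <> S k); [|lia].
      intros ->; rewrite Nat.even_succ, <- Nat.negb_even in Ee.
      destruct (Nat.even k), e; simpl in *; congruence.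
Qed.

Lemma progress_ge k o : (k <= progress k o)%nat.
Proof. unfold progress; destruct (advances k o); lia. Qed.

(** The drive at coordinate 1 belongs to component [a], the one that advances from [k = 0]. *)
Lemma source_progress mu z lin o k j : (progress k o < j)%nat -> source mu z lin o j = 0.
Proof.
  intros Hj; destruct j as [|[|j]]; simpl; [lia| |reflexivity].
  destruct o as [[|]|]; simpl; try ring.
  unfold progress, advances in Hj; destruct k as [|k]; [simpl in Hj; lia|].
  destruct (Bool.eqb _ _); lia.
Qed.

Lemma wswap_supp d sg m o k (y : Vec d) : supp k y -> supp (progress k o) (wswap sg (partner m o) y).
Proof.
  intros Hy i Hi; unfold wswap; rewrite (supp_coord _ k y); [ring|exact Hy|].
  apply partner_progress, Hi.
Qed.

(** Serves the prox, which also swaps the source. In component [a] coordinate 1 is a fixed point, so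
    the drive is not handed on. *)
Lemma source_partner_progress mu z lin m o k j :
  (progress k o < j)%nat -> source mu z lin o (partner m o j) = 0.
Proof.
  intros Hj; pose proof (partner_progress m o k j Hj) as Hp.
  destruct (partner m o j) as [|[|l]] eqn:E; simpl; [lia| |reflexivity].
  destruct o as [[|]|]; simpl; try ring.
  destruct k as [|k]; [|lia].
  unfold progress in Hj; simpl in Hj, E.
  destruct j as [|[|[|j]]]; simpl in E; [lia..| |];
    repeat (match type of E with context [if ?b then _ else _] => destruct b end); lia.
Qed.

Definition comp_source {d} mu z lin o : Vec d := fun i => source mu z lin o (fidx i).

Lemma comp_grad_supp m mu w r z lin o k (y : Vec (S m)) : supp k y ->
  supp (progress k o) (quad_grad (wop mu w (weight m r o) (partner m o)) (comp_source mu z lin o) y).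
Proof.
  intros Hy i Hi; pose proof (wswap_supp _ (weight m r o) m o k y Hy i Hi) as E.
  unfold quad_grad, vsub, wop, comp_source; rewrite E, (source_progress _ _ _ _ k) by exact Hi.
  rewrite (Hy i) by (pose proof (progress_ge k o); lia); ring.
Qed.

(** In the closed form, entry [i] involves [b + x / gamma] only at [i] and its partner, so a prox
    reaches no further than a gradient. *)
Lemma comp_prox_supp m mu w r z lin o gamma k (y : Vec (S m)) : (1 <= m)%nat -> supp k y ->
  supp (progress k o)
    (wop_prox mu w (weight m r o) (partner m o) (comp_source mu z lin o) gamma y).
Proof.
  intros Hm Hy i Hi; pose proof (progress_ge k o).
  assert (Hq : forall j : Fin.t (S m), (k < fidx j)%nat -> source mu z lin o (fidx j) = 0 ->
    vadd (comp_source mu z lin o) (vscale (/ gamma) y) j = 0).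
  { intros j Hj Hs; unfold vadd, vscale, comp_source; rewrite Hs, (Hy j Hj); ring. }
  unfold wop_prox, wswap.
  destruct (partner_spec m o Hm _ (fidx_lt _ i)) as [Hlt _].
  destruct (fidx_surj _ _ Hlt) as [j Ej]; rewrite <- Ej, coord_fidx, (Hq i), (Hq j).
  - unfold Rdiv; ring.
  - rewrite Ej; apply partner_progress, Hi.
  - rewrite Ej; apply (source_partner_progress _ _ _ _ _ k), Hi.
  - lia.
  - apply (source_progress _ _ _ _ k), Hi.
Qed.

(** [B = 0] gives the reflected start, and a suitable [B] the reflected minimizer; both have [z] at
    coordinate 0. *)
Definition chain_sol (B r z : R) (j : nat) : R := match j with O => z | _ => B * r ^ j end.

(* Weighting the last self-loop by [r] makes the geometric sequence an exact solution: the missing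
   value [y_(m+1)] is replaced by [r * y_m]. *)
Lemma chain_sol_diff m B r z e (j : nat) : (1 <= j <= m)%nat ->
  chain_sol B r z j - weight m r (Some e) j * chain_sol B r z (partner m (Some e) j)
  = if Bool.eqb (Nat.even j) e then B * r ^ j * (1 - r)
    else if Nat.eqb j 1 then 0 else - (B * r ^ pred j * (1 - r)).
Proof.
  intros Hj; unfold partner, weight.
  destruct (Nat.eqb_spec j 0) as [|_]; [lia|].
  destruct (Bool.eqb (Nat.even j) e) eqn:Ee.
  - destruct (Nat.ltb_spec j m) as [H|H].
    + destruct (Nat.eqb_spec j m); [lia|]; destruct j as [|j]; [lia|]; simpl; ring.
    + assert (j = m) as -> by lia.
      rewrite Nat.eqb_refl, Ee; destruct m as [|m]; [lia|]; simpl; ring.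
  - assert (E : (Nat.eqb j m && Bool.eqb (Nat.even m) e)%bool = false).
    { destruct (Nat.eqb_spec j m) as [->|]; [rewrite Ee|]; reflexivity. }
    rewrite E; destruct (Nat.eqb_spec j 1) as [->|H1]; [simpl; ring|].
    destruct j as [|[|j]]; [lia..|]; simpl; ring.
Qed.

(** [G o] is a gradient coordinate for type [o]. The sum is a linear recurrence for [r^j] whose
    characteristic equation is the hypothesis on [w]; at coordinate 1, [lin] makes up for the
    missing left link. *)
Lemma chain_sol_stationary m mu w r z lin B n j : (1 <= m)%nat -> (j < S m)%nat -> r <> 1 ->
  w * ((1 - r) * (1 - r)) = n * mu * r -> lin = n * (mu * B * r / (1 - r)) ->
  let G o := mu * chain_sol B r z j
             + w * (chain_sol B r z j - weight m r o j * chain_sol B r z (partner m o j))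
             - source mu z lin o j in
  (n - 2) * G None + G (Some true) + G (Some false) = 0.
Proof.
  intros Hm Hj Hr Hw Hlin G; unfold G.
  destruct j as [|j]; [destruct m as [|m]; [lia|]; simpl; ring|].
  rewrite !(chain_sol_diff _ _ _ _ _ (S j)) by lia.
  assert (Hr' : 1 - r <> 0) by lra.
  destruct j as [|j].
  - simpl; rewrite Hlin.
    replace w with (n * mu * r / ((1 - r) * (1 - r))) by (rewrite <- Hw; field; lra).
    field; lra.
  - replace (source mu z lin None (S (S j))) with 0 by reflexivity.
    replace (source mu z lin (Some true) (S (S j))) with 0 by reflexivity.
    replace (source mu z lin (Some false) (S (S j))) with 0 by reflexivity.
    replace (Nat.eqb (S (S j)) 1) with false by reflexivity.
    set (e := Nat.even (S (S j))).
    assert (Hp : w * (B * r ^ S (S j) * (1 - r)) + w * - (B * r ^ pred (S (S j)) * (1 - r))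
                 + n * mu * (B * r ^ S (S j)) = 0).
    { simpl; replace (n * mu * (B * (r * (r * r ^ j)))) with (n * mu * r * (B * r * r ^ j)) by ring.
      rewrite <- Hw; ring. }
    unfold weight, partner, chain_sol; destruct e; simpl Bool.eqb; cbv iota;
      (etransitivity; [|exact Hp]; ring).
Qed.

(** * Expected progress of a run *)

Lemma in_span_closed d (W : Vec d -> Prop) vs v :
  W vzero -> (forall x y, W x -> W y -> W (vadd x y)) -> (forall a x, W x -> W (vscale a x)) ->
  Forall W vs -> in_span vs v -> W v.
Proof.
  intros H0 Ha Hs Hvs [cs ->]; revert cs; induction Hvs as [|v0 vs Hv _ IH]; intros [|c cs];
    simpl; auto.
Qed.

(* The lower bound is propagated by [E rho^(K_(t+1)) >= (1 - q (1 - rho)) E rho^(K_t)], as the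
   progress [K_t] increases by at most one, and only when one particular index is drawn. *)
Lemma expect_run_ge n d (A : PIFO n) fs gfs prx (W : nat -> Vec d -> Prop) (Phi : Vec d -> R)
    (q rho K T : R) :
  is_PIFO A ->
  (forall k, W k vzero) -> (forall k x y, W k x -> W k y -> W k (vadd x y)) ->
  (forall k a x, W k x -> W k (vscale a x)) -> (forall k x, W k x -> W (S k) x) ->
  (forall k, exists g, pifo_p A g <= q /\
     forall j x gamma, 0 < gamma -> W k x ->
       W (if Fin.eq_dec j g then S k else k) (gfs j x) /\
       W (if Fin.eq_dec j g then S k else k) (prx j gamma x)) ->
  0 <= q <= 1 -> 0 < rho <= 1 -> 0 <= K ->
  (forall k x, W k x -> K * rho ^ k + T <= Phi x) ->
  forall t h k, Forall (W k) (hist_vectors (pifo_x0 A d) h) ->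
  K * (rho ^ k * (1 - q * (1 - rho)) ^ t) + T <=
  expect (pifo_p A) t (fun s => Phi (cur_iterate A (run A fs gfs prx h s))).
Proof.
  intros (Hp0 & Hp1 & Hgam & Hspan) HW0 HWa HWs HWS Hstep Hq Hrho HK HPhi.
  assert (Hcur : forall h k, Forall (W k) (hist_vectors (pifo_x0 A d) h) -> W k (cur_iterate A h)).
  { intros [|o h] k Hh; unfold cur_iterate; [exact (Forall_inv Hh)|].
    eapply in_span_closed; [apply HW0|apply HWa|apply HWs|exact Hh|apply Hspan; discriminate]. }
  set (th := 1 - q * (1 - rho)).
  assert (Hth : 0 < th) by (unfold th; nra).
  induction t as [|t IH]; intros h k Hh.
  - simpl; rewrite Rmult_1_r; apply HPhi, Hcur, Hh.
  - cbn [expect run].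
    destruct (Hstep k) as (g & Hpg & Hg).
    set (V := K * (rho ^ k * th ^ t)).
    assert (HV : 0 <= V).
    { apply Rmult_le_pos; [exact HK|].
      apply Rmult_le_pos; apply pow_le; lra. }
    apply Rle_trans with (fsum n (fun j => (V + T) * pifo_p A j
      - (if Fin.eq_dec j g then pifo_p A g * ((1 - rho) * V) else 0))).
    + rewrite fsum_minus, fsum_scal, Hp1, fsum_indicator.
      replace (K * (rho ^ k * th ^ S t)) with (V * th) by (unfold V; simpl; ring).
      assert (HX : 0 <= (1 - rho) * V) by (apply Rmult_le_pos; lra).
      pose proof (Rmult_le_compat_r _ _ _ HX Hpg) as Hle; unfold th; lra.
    + apply fsum_le; intros j.
      set (o := Obs (cur_iterate A h) j _ _ _).
      assert (Hh' : Forall (W (if Fin.eq_dec j g then S k else k))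
                      (hist_vectors (pifo_x0 A d) (h ++ [o]))).
      { destruct (Hg j (cur_iterate A h) (pifo_gamma A (S (length h)))
          (Hgam (S (length h)) ltac:(lia)) (Hcur h k Hh)) as [H1 H2].
        assert (HWup : forall x, W k x -> W (if Fin.eq_dec j g then S k else k) x)
          by (intros x Hx; destruct (Fin.eq_dec j g); auto).
        unfold hist_vectors; rewrite flat_map_app, app_comm_cons; apply Forall_app; split.
        - eapply Forall_impl; [exact HWup|exact Hh].
        - simpl; repeat constructor; auto. }
      specialize (IH _ _ Hh'); apply Rle_trans with (2 := Rmult_le_compat_l _ _ _ (Hp0 j) IH).
      destruct (Fin.eq_dec j g) as [->|_].
      * replace (K * (rho ^ S k * th ^ t)) with (rho * V) by (unfold V; simpl; ring).
        apply Req_le; ring.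
      * fold V; apply Req_le; ring.
Qed.

Lemma exists_le_or_fsum_gt n (p : Fin.t (S n) -> R) t :
  (exists a, p a <= t) \/ INR (S n) * t < fsum (S n) p.
Proof.
  induction n as [|n IH].
  - destruct (Rle_lt_dec (p Fin.F1) t) as [H|H]; [left; eauto|right; simpl; lra].
  - destruct (Rle_lt_dec (p Fin.F1) t) as [H|H]; [left; eauto|].
    destruct (IH (fun i => p (Fin.FS i))) as [[a Ha]|H']; [left; eauto|right].
    rewrite S_INR; cbn [fsum] in *; lra.
Qed.

(** If at most one of the [n + 1] entries is at most [t], the other [n] exceed it, and the
    exceptional one is nonnegative. *)
Lemma exists_two_le_or_fsum_gt n (p : Fin.t (S n) -> R) t : (forall i, 0 <= p i) -> (1 <= n)%nat ->
  (exists a b, a <> b /\ p a <= t /\ p b <= t) \/ INR n * t < fsum (S n) p.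
Proof.
  revert p; induction n as [|n IH]; intros p Hp Hn; [lia|].
  destruct (Rle_lt_dec (p Fin.F1) t) as [H|H].
  - destruct (exists_le_or_fsum_gt n (fun i => p (Fin.FS i)) t) as [[a Ha]|H'].
    + left; exists Fin.F1, (Fin.FS a); repeat split; auto; discriminate.
    + right; specialize (Hp Fin.F1); cbn [fsum] in *; lra.
  - destruct n as [|n].
    + right; simpl; specialize (Hp (Fin.FS Fin.F1)); lra.
    + destruct (IH (fun i => p (Fin.FS i)) (fun i => Hp (Fin.FS i)) ltac:(lia)) as [(a & b & Hab & Ha & Hb)|H'].
      * left; exists (Fin.FS a), (Fin.FS b); repeat split; auto.
        intros E; apply Fin.FS_inj in E; contradiction.
      * right; rewrite S_INR; cbn [fsum] in *; lra.
Qed.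

Lemma exists_two_small n (p : Fin.t n -> R) : (2 <= n)%nat ->
  (forall i, 0 <= p i) -> fsum n p = 1 ->
  exists a b, a <> b /\ p a <= 2 / INR n /\ p b <= 2 / INR n.
Proof.
  intros Hn Hp Hs; destruct n as [|n]; [lia|].
  destruct (exists_two_le_or_fsum_gt n p (2 / INR (S n)) Hp ltac:(lia)) as [H|H]; [exact H|].
  rewrite Hs in H; exfalso; apply le_INR in Hn; simpl (INR 2) in Hn.
  (* Were all entries but one above the threshold, the sum would exceed this value, which is at
     least 1. *)
  assert (E : INR n * (2 / INR (S n)) = 2 - 2 / INR (S n)) by (rewrite S_INR in *; field; lra).
  assert (2 / INR (S n) <= 1) by (
     apply (Rmult_le_reg_r (INR (S n))); [lra|]; unfold Rdiv; rewrite Rmult_assoc, Rinv_l; lra).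
  lra.
Qed.

Lemma fsum_types n (a b : Fin.t n) (g : option bool -> R) : a <> b ->
  fsum n (fun i => g (if Fin.eq_dec i a then Some true
                      else if Fin.eq_dec i b then Some false else None))
  = (INR n - 2) * g None + g (Some true) + g (Some false).
Proof.
  intros Hab.
  rewrite (fsum_ext _ _ (fun i => g None + (if Fin.eq_dec i a then g (Some true) - g None else 0)
    + (if Fin.eq_dec i b then g (Some false) - g None else 0))).
  - rewrite !fsum_plus, fsum_const, !fsum_indicator; ring.
  - intros i; destruct (Fin.eq_dec i a) as [Ea|Ea]; destruct (Fin.eq_dec i b) as [Eb|Eb];
      [congruence|lra..].
Qed.

(** * The hard instance *)

(** The trapezoidal rule is exact for quadratics. It yields the initial gap from the gradients at
    the start and at the minimizer, both explicit. *)
Lemma quad_trapezoid d (M : Vec d -> Vec d) b : symmetric M -> forall x y,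
  quad M b y - quad M b x
  = / 2 * (dot (quad_grad M b x) (vsub y x) + dot (quad_grad M b y) (vsub y x)).
Proof.
  intros Msym x y; unfold quad, quad_grad; rewrite !dot_sub_l, !dot_sub_r.
  rewrite (Msym x y), (Msym x x), (Msym y x), (Msym y y), (dot_comm _ y (M x)), (Msym x y); lra.
Qed.

Lemma quad_grad_conjugate d (H M : Vec d -> Vec d) b x : symmetric H ->
  quad_grad (conjugate H M) (H b) x = H (quad_grad M b (H x)).
Proof. intros Hs; unfold quad_grad, conjugate; rewrite (symmetric_sub _ _ Hs); reflexivity. Qed.

(** [H] is a linear isometry and its own inverse, so applying it carries the optimality condition
    over. *)
Lemma quad_is_prox_conjugate d (H M : Vec d -> Vec d) b gamma x u :
  symmetric H -> (forall y, H (H y) = y) -> symmetric M -> (forall h, 0 <= dot h (M h)) ->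
  0 < gamma -> (forall i, quad_grad M b u i + / gamma * (u i - H x i) = 0) ->
  is_prox (quad (conjugate H M) (H b)) gamma x (H u).
Proof.
  intros Hs Hi Ms Mpos Hg Hu.
  apply quad_is_prox; [apply conjugate_symmetric; assumption| |exact Hg|].
  - intros h; unfold conjugate; rewrite <- Hs; apply Mpos.
  - intros i; rewrite quad_grad_conjugate, Hi by exact Hs.
    assert (E : vadd (H (quad_grad M b u)) (vscale (/ gamma) (vsub (H u) x)) = vscale 0 (H u)).
    { rewrite <- (Hi x) at 1.
      rewrite <- (symmetric_sub _ _ Hs), <- !(symmetric_scale _ _ Hs), <- (symmetric_add _ _ Hs).
      f_equal; apply functional_extensionality; intros j; specialize (Hu j).
      unfold vadd, vscale, vsub in *; lra. }
    apply (f_equal (fun v => v i)) in E; unfold vadd, vscale, vsub in E; lra.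
Qed.

Lemma geometric_fsum rho d : (1 - rho) * fsum d (fun i => rho ^ fidx i) = 1 - rho ^ d.
Proof.
  induction d as [|d IH]; simpl; [ring|].
  rewrite fsum_scal; replace (_ * (1 + _))
    with (1 - rho + rho * ((1 - rho) * fsum d (fun i => rho ^ fidx i))) by ring.
  rewrite IH; ring.
Qed.

(** Equality holds for [k < d]; otherwise the sum is empty and the left side nonpositive. *)
Lemma geometric_tail_ge rho d k : 0 < rho <= 1 ->
  rho ^ S k - rho ^ d <= (1 - rho) * fsum d (fun i => if Nat.ltb k (fidx i) then rho ^ fidx i else 0).
Proof.
  intros Hrho; revert k; induction d as [|d IH]; intros k.
  - simpl; assert (0 < rho ^ k <= 1); [|nra].
    split; [apply pow_lt; lra|]. rewrite <- (pow1 k); apply pow_incr; lra.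
  - cbn [fsum fidx]; rewrite (proj2 (Nat.ltb_ge k 0)) by lia.
    destruct k as [|k].
    + rewrite (fsum_ext _ _ (fun i => rho * rho ^ fidx i)) by reflexivity.
      rewrite fsum_scal; pose proof (geometric_fsum rho d).
      apply Req_le; simpl; nra.
    + rewrite (fsum_ext _ _ (fun i => rho * (if Nat.ltb k (fidx i) then rho ^ fidx i else 0))).
      * rewrite fsum_scal; specialize (IH k); simpl in *.
        apply (Rmult_le_compat_l rho) in IH; [|lra]. lra.
      * intros i; change (Nat.ltb (S k) (S (fidx i))) with (Nat.ltb k (fidx i)).
        destruct (Nat.ltb k (fidx i)); simpl; ring.
Qed.

Definition chain_vec {d} (B r z : R) : Vec d := fun i => chain_sol B r z (fidx i).

(** Beyond coordinate [k] the difference is minus the geometric sequence, whose tail is summed; the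
    other coordinates are dropped. *)
Lemma sqnorm_chain_tail_ge m B r z k (y : Vec (S m)) : 0 < r < 1 -> supp k y ->
  B * B * ((r * r) ^ S k - (r * r) ^ S m) <= (1 - r * r) * sqnorm (vsub y (chain_vec B r z)).
Proof.
  intros Hr Hy.
  pose proof (geometric_tail_ge (r * r) (S m) k ltac:(nra)) as Hg.
  apply (Rmult_le_compat_l (B * B)) in Hg; [|nra].
  apply Rle_trans with (1 := Hg).
  replace (B * B * _) with ((1 - r * r) * (B * B * fsum (S m)
    (fun i => if Nat.ltb k (fidx i) then (r * r) ^ fidx i else 0))) by ring.
  apply Rmult_le_compat_l; [nra|]. rewrite <- fsum_scal.
  apply fsum_le; intros i; destruct (Nat.ltb_spec k (fidx i)) as [Hk|Hk].
  - unfold vsub; rewrite (Hy i Hk); unfold chain_vec.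
    destruct (fidx i) as [|l]; [lia|]; unfold chain_sol.
    rewrite Rpow_mult_distr; apply Req_le; ring.
  - pose proof (Rle_0_sqr (vsub y (chain_vec B r z) i)); unfold Rsqr in *; lra.
Qed.

Lemma wop_grad_chain m mu w r z lin B o (i : Fin.t (S m)) : (1 <= m)%nat ->
  quad_grad (wop mu w (weight m r o) (partner m o)) (comp_source mu z lin o) (chain_vec B r z) i
  = mu * chain_sol B r z (fidx i)
    + w * (chain_sol B r z (fidx i)
           - weight m r o (fidx i) * chain_sol B r z (partner m o (fidx i)))
    - source mu z lin o (fidx i).
Proof.
  intros Hm; unfold quad_grad, vsub, wop, wswap, comp_source, chain_vec.
  rewrite (coord_mk _ (chain_sol B r z)) by (apply partner_spec; [exact Hm|apply fidx_lt]); reflexivity.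
Qed.

(** The start vanishes on the chain, so only the drive at coordinate 1 survives there; at coordinate
    0 the two points agree. *)
Lemma dot_wop_grad_start m mu w r z lin B o : (1 <= m)%nat ->
  dot (quad_grad (wop mu w (weight m r o) (partner m o)) (comp_source mu z lin o)
         (@chain_vec (S m) 0 r z))
      (vsub (chain_vec 0 r z) (chain_vec B r z))
  = drive o * (lin * B * r).
Proof.
  intros Hm; unfold dot.
  rewrite (fsum_ext _ _ (fun i => if Nat.eqb (fidx i) 1 then drive o * (lin * B * r) else 0)).
  - destruct m as [|m]; [lia|]; cbn [fsum fidx Nat.eqb].
    rewrite fsum_const; ring.
  - intros i; rewrite wop_grad_chain by exact Hm; unfold vsub, chain_vec.
    pose proof (fidx_lt _ i) as Hi; destruct (fidx i) as [|l] eqn:E; [simpl; ring|].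
    assert (D : chain_sol 0 r z (S l)
                - weight m r o (S l) * chain_sol 0 r z (partner m o (S l)) = 0).
    { destruct o as [e|]; [|simpl; ring].
      rewrite chain_sol_diff by lia.
      destruct (Bool.eqb _ _); [ring|]; destruct (Nat.eqb _ _); ring. }
    rewrite D; destruct l as [|l]; simpl; ring.
Qed.

Lemma hard_instance n m (L mu r Delta : R) (A : PIFO n) :
  (2 <= n)%nat -> (1 <= m)%nat -> 0 < mu -> mu <= L -> 0 < r < 1 -> 0 < Delta ->
  (L - mu) / 2 * ((1 - r) * (1 - r)) = INR n * mu * r -> is_PIFO A ->
  exists (fs : Fin.t n -> Vec (S m) -> R) (gfs : Fin.t n -> Vec (S m) -> Vec (S m))
         (prx : Fin.t n -> R -> Vec (S m) -> Vec (S m)) (xstar : Vec (S m)),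
    (forall j, is_gradient (fs j) (gfs j)) /\
    (forall j, L_smooth L (gfs j)) /\
    (forall j, strongly_convex mu (fs j) (gfs j)) /\
    (forall j gamma x, 0 < gamma -> is_prox (fs j) gamma x (prx j gamma x)) /\
    (forall y, favg fs xstar <= favg fs y) /\
    favg fs (pifo_x0 A (S m)) - favg fs xstar = Delta /\
    (forall t, Delta / 2 * ((1 - 2 / INR n * (1 - r * r)) ^ t - (r * r) ^ m) <=
       expect (pifo_p A) t (fun s => favg fs (iterate A fs gfs prx s)) - favg fs xstar).
Proof.
  intros Hn Hm Hmu HL Hr HDelta Hw HA.
  assert (Hn2 : 2 <= INR n) by (apply le_INR in Hn; simpl in Hn; lra).
  destruct (exists_two_small n (pifo_p A) Hn (proj1 HA) (proj1 (proj2 HA)))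
    as (a & b & Hab & Hpa & Hpb).
  destruct (exists_reflection m (pifo_x0 A (S m))) as (z & H & Hs & Hi & Hx0).
  set (w := (L - mu) / 2) in *.
  assert (Hw0 : 0 <= w) by (unfold w; lra).
  assert (EL : mu + 2 * w = L) by (unfold w; field).
  (* The initial gap is [mu * B^2 * r^2 / (2 * (1 - r))], and this [B] makes it [Delta]. *)
  set (B := sqrt (2 * (1 - r) * Delta / (mu * (r * r)))).
  assert (HB : B * B = 2 * (1 - r) * Delta / (mu * (r * r))).
  { apply sqrt_sqrt, Rlt_le, Rdiv_lt_0_compat.
    - apply Rmult_lt_0_compat; lra.
    - apply Rmult_lt_0_compat; nra. }
  set (lin := INR n * (mu * B * r / (1 - r))).
  set (ty := fun i : Fin.t n => if Fin.eq_dec i a then Some true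
               else if Fin.eq_dec i b then Some false else None).
  assert (Hty : forall g, fsum n (fun j => g (ty j))
    = (INR n - 2) * g None + g (Some true) + g (Some false))
    by (intros g; apply (fsum_types n a b g Hab)).
  set (M0 := fun o => @wop (S m) mu w (weight m r o) (partner m o)).
  set (b0 := fun o => @comp_source (S m) mu z lin o).
  set (M := fun o => conjugate H (M0 o)).
  assert (Hinv : forall o, weighted_involution (S m) (weight m r o) (partner m o))
    by (intros o; apply chain_involution; [exact Hm|lra]).
  assert (HM0s : forall o, symmetric (M0 o)) by (intros o; apply wop_symmetric, Hinv).
  assert (HMs : forall o, symmetric (M o)) by (intros o; apply conjugate_symmetric; auto).
  assert (HHn : forall h, sqnorm (H h) = sqnorm h) by (intros h; apply reflection_dot; auto).
  assert (HMb : forall o h, mu * sqnorm h <= dot h (M o h) <= L * sqnorm h).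
  { intros o h; unfold M, conjugate; rewrite <- Hs, <- (HHn h), <- EL; apply wop_bounds; auto. }
  assert (HMn : forall o h, sqnorm (M o h) <= L * L * sqnorm h).
  { intros o h; unfold M, conjugate; rewrite HHn, <- (HHn h), <- EL; apply wop_bounds; auto. }
  assert (HG : forall o x, quad_grad (M o) (H (b0 o)) x = H (quad_grad (M0 o) (b0 o) (H x)))
    by (intros o x; apply quad_grad_conjugate, Hs).
  set (fs := fun j => quad (M (ty j)) (H (b0 (ty j)))).
  set (gfs := fun j => quad_grad (M (ty j)) (H (b0 (ty j)))).
  set (prx := fun j g x => H (wop_prox mu w (weight m r (ty j)) (partner m (ty j))
                                (b0 (ty j)) g (H x))).
  set (xstar := H (chain_vec B r z)).
  assert (Hx0' : H (pifo_x0 A (S m)) = chain_vec 0 r z).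
  { rewrite Hx0; apply functional_extensionality; intros i; unfold chain_vec.
    destruct (fidx i); simpl; ring. }
  assert (Hstat : forall h, fsum n (fun j => dot (gfs j xstar) h) = 0).
  { intros h; unfold gfs, xstar.
    rewrite (fsum_ext _ _ (fun j => fsum (S m) (fun i =>
      quad_grad (M0 (ty j)) (b0 (ty j)) (chain_vec B r z) i * H h i)))
      by (intros j; rewrite HG, Hi, Hs; reflexivity).
    rewrite fsum_exchange, (fsum_ext _ _ (fun _ => 0)); [rewrite fsum_const; ring|intros i].
    rewrite (fsum_ext _ _ (fun j => H h i * quad_grad (M0 (ty j)) (b0 (ty j)) (chain_vec B r z) i))
      by (intros j; ring).
    rewrite fsum_scal.
    rewrite (Hty (fun o => quad_grad (M0 o) (b0 o) (chain_vec B r z) i)).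
    unfold M0, b0; rewrite !wop_grad_chain by exact Hm.
    rewrite (chain_sol_stationary m mu w r z lin B (INR n) (fidx i) Hm (fidx_lt _ i));
      [ring|lra|exact Hw|reflexivity]. }
  assert (Hgrow : forall x, favg fs xstar + mu / 2 * sqnorm (vsub x xstar) <= favg fs x).
  { intros x; unfold favg.
    rewrite (fsum_ext _ (fun j => fs j x) (fun j => fs j xstar + dot (gfs j xstar) (vsub x xstar)
      + / 2 * dot (vsub x xstar) (M (ty j) (vsub x xstar))))
      by (intros j; apply quad_expand, HMs).
    rewrite !fsum_plus, Hstat, fsum_scal.
    assert (E : INR n * (mu * sqnorm (vsub x xstar)) <=
      fsum n (fun j => dot (vsub x xstar) (M (ty j) (vsub x xstar)))).
    { rewrite <- fsum_const; apply fsum_le; intros j; apply HMb. }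
    replace (mu / 2 * sqnorm (vsub x xstar))
      with (/ INR n * (/ 2 * (INR n * (mu * sqnorm (vsub x xstar))))) by (field; lra).
    rewrite <- Rmult_plus_distr_l; apply Rmult_le_compat_l;
      [apply Rlt_le, Rinv_0_lt_compat; lra|lra]. }
  assert (Hgap : favg fs (pifo_x0 A (S m)) - favg fs xstar = Delta).
  { set (x0 := pifo_x0 A (S m)) in *; unfold favg.
    rewrite <- Rmult_minus_distr_l, <- fsum_minus.
    rewrite (fsum_ext _ _ (fun j => / 2 * (dot (gfs j xstar) (vsub x0 xstar)
      + dot (gfs j x0) (vsub x0 xstar)))) by (intros j; apply quad_trapezoid, HMs).
    rewrite fsum_scal, fsum_plus, Hstat.
    rewrite (fsum_ext _ _ (fun j => drive (ty j) * (lin * B * r))).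
    - rewrite (Hty (fun o => drive o * (lin * B * r))); simpl; unfold lin.
      transitivity (B * B * (mu * (r * r)) / (2 * (1 - r))); [field; lra|].
      rewrite HB; field; split; nra.
    - intros j; unfold gfs; rewrite HG, Hs, (symmetric_sub _ _ Hs).
      unfold xstar; rewrite Hi, Hx0'; apply dot_wop_grad_start, Hm. }
  exists fs, gfs, prx, xstar; repeat split.
  - intros j; apply quad_is_gradient with L; [apply HMs|lra|].
    intros h; pose proof (HMb (ty j) h); pose proof (sqnorm_ge0 _ h); nra.
  - intros j; apply quad_L_smooth; [apply HMs|lra|apply HMn].
  - intros j; apply quad_strongly_convex; [apply HMs|]; intros h; apply HMb.
  - intros j gamma x Hg; unfold fs, prx, M; apply quad_is_prox_conjugate; auto.
    + intros h; pose proof (wop_bounds _ mu w _ _ h (Hinv (ty j)) Hmu Hw0) as [[Hlow _] _].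
      pose proof (sqnorm_ge0 _ h); unfold M0; nra.
    + intros i; apply wop_prox_spec; auto.
  - intros y; specialize (Hgrow y); pose proof (sqnorm_ge0 _ (vsub y xstar)); nra.
  - exact Hgap.
  - intros t.
    assert (Hrho : 0 < r * r < 1) by nra.
    (* Quadratic growth and the tail estimate give the factor [Delta / (1 + r)], which exceeds
       [Delta / 2]. A nonpositive difference of powers is trivial. *)
    assert (Hlow : forall k x, supp k (H x) ->
      Delta / 2 * (r * r) ^ k + (favg fs xstar - Delta / 2 * (r * r) ^ m) <= favg fs x).
    { intros k x Hk; specialize (Hgrow x).
      assert (Hsq : sqnorm (vsub x xstar) = sqnorm (vsub (H x) (chain_vec B r z))).
      { unfold xstar; rewrite <- (Hi x) at 1; rewrite <- (symmetric_sub _ _ Hs); apply HHn. }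
      pose proof (sqnorm_ge0 _ (vsub x xstar)) as Hpos.
      assert (Hdiff : Delta / 2 * ((r * r) ^ k - (r * r) ^ m) <= mu / 2 * sqnorm (vsub x xstar));
        [|lra].
      destruct (Rle_lt_dec ((r * r) ^ k - (r * r) ^ m) 0) as [Hneg|Hp]; [nra|].
      pose proof (sqnorm_chain_tail_ge m B r z k (H x) Hr Hk) as Ht; rewrite <- Hsq in Ht.
      set (X := (r * r) ^ k - (r * r) ^ m) in *; set (N := sqnorm (vsub x xstar)) in *.
      replace ((r * r) ^ S k - (r * r) ^ S m) with (r * r * X) in Ht by (unfold X; simpl; ring).
      rewrite HB in Ht.
      replace (2 * (1 - r) * Delta / (mu * (r * r)) * (r * r * X))
        with (/ mu * (1 - r) * (2 * Delta * X)) in Ht by (field; split; lra).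
      replace ((1 - r * r) * N) with (/ mu * (1 - r) * (mu * (1 + r) * N)) in Ht by (field; lra).
      apply Rmult_le_reg_l in Ht;
        [|apply Rmult_lt_0_compat; [apply Rinv_0_lt_compat|]; lra].
      assert (0 <= mu * N) by (apply Rmult_le_pos; lra); nra. }
    pose proof (expect_run_ge n (S m) A fs gfs prx (fun k x => supp k (H x)) (favg fs)
      (2 / INR n) (r * r) (Delta / 2) (favg fs xstar - Delta / 2 * (r * r) ^ m) HA) as Hrun.
    cbv beta in Hrun.
    assert (Hq : 0 <= 2 / INR n <= 1).
    { split; [apply Rlt_le, Rdiv_lt_0_compat; lra|].
      apply (Rmult_le_reg_r (INR n)); [lra|]; unfold Rdiv; rewrite Rmult_assoc, Rinv_l; lra. }
    assert (HH0 : H vzero = vzero).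
    { replace (@vzero (S m)) with (vscale 0 (@vzero (S m)))
        by (apply functional_extensionality; intros i; unfold vscale, vzero; ring).
      rewrite (symmetric_scale _ _ Hs).
      apply functional_extensionality; intros i; unfold vscale, vzero; ring. }
    specialize (Hrun ltac:(intros k; rewrite HH0; intros i _; reflexivity)).
    specialize (Hrun ltac:(intros k x y Hx Hy; rewrite (symmetric_add _ _ Hs); intros i Hk;
      unfold vadd; rewrite (Hx i Hk), (Hy i Hk); ring)).
    specialize (Hrun ltac:(intros k c x Hx; rewrite (symmetric_scale _ _ Hs); intros i Hk;
      unfold vscale; rewrite (Hx i Hk); ring)).
    specialize (Hrun ltac:(intros k x; apply supp_le; lia)).
    assert (Hstep : forall k, exists g, pifo_p A g <= 2 / INR n /\
      forall j x gamma, 0 < gamma -> supp k (H x) ->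
       supp (if Fin.eq_dec j g then S k else k) (H (gfs j x)) /\
       supp (if Fin.eq_dec j g then S k else k) (H (prx j gamma x))).
    (* The next link is in component [a] for even [k] and in [b] for odd [k]. *)
    { intros k; exists (if Nat.even k then a else b); split; [destruct (Nat.even k); assumption|].
      intros j x gamma _ Hx.
      replace (if Fin.eq_dec j (if Nat.even k then a else b) then S k else k)
        with (progress k (ty j)).
      - unfold gfs, prx; rewrite HG, !Hi; split.
        + apply comp_grad_supp, Hx.
        + apply comp_prox_supp; assumption.
      - unfold ty, progress, advances.
        destruct (Nat.even k), (Fin.eq_dec j a), (Fin.eq_dec j b); simpl; congruence. }
    specialize (Hrun Hstep Hq ltac:(lra) ltac:(lra) Hlow t [] 0%nat).
    assert (Hh : Forall (fun x => supp 0 (H x)) (hist_vectors (n := n) (pifo_x0 A (S m)) [])).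
    { constructor; [|constructor]; rewrite Hx0'; intros i Hk; unfold chain_vec.
      destruct (fidx i); [lia|]; simpl; ring. }
    specialize (Hrun Hh); unfold iterate; simpl pow at 1 in Hrun; lra.
Qed.

(** * Choice of the parameters *)

Lemma pow_exp x m : exp x ^ m = exp (INR m * x).
Proof.
  induction m as [|m IH]; [simpl; rewrite Rmult_0_l, exp_0; reflexivity|].
  rewrite S_INR; simpl; rewrite IH, <- exp_plus; f_equal; ring.
Qed.

Lemma exists_nat_ceil x : 0 < x -> exists m : nat, (1 <= m)%nat /\ x <= INR m <= x + 1.
Proof.
  intros Hx; destruct (archimed x) as [H1 H2].
  assert (Hz : (0 < up x)%Z) by (apply lt_IZR; lra).
  exists (Z.to_nat (up x)); rewrite INR_IZR_INZ, Z2Nat.id by lia; split; [lia|lra].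
Qed.

(** [exp (- 36 x) <= 1 / (1 + 36 x) <= 1 - x], where the last step amounts to
    [x (35 - 36 x) >= 0]. *)
Lemma pow_ge_exp x t : 0 <= x <= 35 / 36 -> exp (- (INR t * (36 * x))) <= (1 - x) ^ t.
Proof.
  intros Hx; replace (- (INR t * (36 * x))) with (INR t * - (36 * x)) by ring.
  rewrite <- pow_exp; apply pow_incr; split; [apply Rlt_le, exp_pos|].
  rewrite exp_Ropp; apply (Rmult_le_reg_r (exp (36 * x))); [apply exp_pos|].
  rewrite Rinv_l by (apply Rgt_not_eq, exp_pos).
  pose proof (exp_ineq1_le (36 * x)); nra.
Qed.

Theorem theorem3p1 :
  exists c C : R, 0 < c /\ 0 < C /\
  forall (n : nat) (L mu Delta eps : R),
    (2 <= n)%nat -> 0 < L -> 0 < mu -> 0 < Delta -> 0 < eps ->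
    L / mu >= INR n / 2 + 1 ->
    eps / Delta <= 327 / 100000 ->
    forall A : PIFO n, is_PIFO A ->
    exists (d : nat) (fs : Fin.t n -> Vec d -> R)
           (gfs : Fin.t n -> Vec d -> Vec d)
           (prx : Fin.t n -> R -> Vec d -> Vec d) (xstar : Vec d),
      INR d <= C * sqrt ((L / mu) / INR n) * ln (Delta / eps) /\
      (forall j, is_gradient (fs j) (gfs j)) /\
      (forall j, L_smooth L (gfs j)) /\
      (forall j, strongly_convex mu (fs j) (gfs j)) /\
      (forall j gamma x, 0 < gamma -> is_prox (fs j) gamma x (prx j gamma x)) /\
      (forall y, favg fs xstar <= favg fs y) /\
      favg fs (pifo_x0 A d) - favg fs xstar = Delta /\
      (forall t : nat,
         INR t <= c * (INR n + sqrt ((L / mu) * INR n)) * ln (Delta / eps) ->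
         expect (pifo_p A) t (fun s => favg fs (iterate A fs gfs prx s))
           - favg fs xstar >= eps).
Proof.
  (* [576 = 2 * 36 * 8]: 8 from the bound on [x], 36 from [pow_ge_exp], 2 from the target exponent
     [Lam / 2]. The 5 is 1 for [(Q + 1) * Lam / 4] plus 4 for the rounding and coordinate 0, in
     units of [S0 * Lam]. *)
  exists (/ 576), 5; split; [lra|]; split; [lra|].
  intros n L mu Delta eps Hn HL Hmu HDelta Heps Hkappa Hratio A HA.
  set (kappa := L / mu) in *; set (N := INR n) in *.
  assert (HN : 2 <= N) by (apply le_INR in Hn; simpl in Hn; exact Hn).
  assert (EL : L = kappa * mu) by (unfold kappa; field; lra).
  set (Lam := ln (Delta / eps)).
  assert (Hexp : exp Lam = Delta / eps) by (apply exp_ln, Rdiv_lt_0_compat; lra).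
  assert (Eeps : eps = Delta * exp (- Lam)) by (rewrite exp_Ropp, Hexp; field; lra).
  assert (Heta : exp (- Lam) <= 327 / 100000).
  { replace (exp (- Lam)) with (eps / Delta); [exact Hratio|].
    rewrite exp_Ropp, Hexp; field; lra. }
  assert (HLam : 1 <= Lam).
  { destruct (Rle_lt_dec 1 Lam) as [|Hlt]; [assumption|exfalso].
    assert (exp (- (1)) < exp (- Lam)) by (apply exp_increasing; lra).
    assert (/ 3 <= exp (- (1))); [|lra].
    rewrite exp_Ropp; apply Rinv_le_contravar; [apply exp_pos|exact exp_le_3]. }
  (* The Hessian of the average lies between [mu] and [mu * Q^2], the path Laplacian having norm at
     most 4. The assumption on [kappa] makes [Q] comparable to [S0] and gives [Q^2 >= 2]. *)
  set (S0 := sqrt (kappa / N)); set (Q := sqrt (1 + 2 * (kappa - 1) / N)).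
  assert (HNi : N * / N = 1) by (apply Rinv_r; lra).
  assert (HNp : 0 < / N) by (apply Rinv_0_lt_compat; lra).
  assert (HkN : / 2 + / N <= kappa / N).
  { unfold Rdiv; apply Rle_trans with ((N / 2 + 1) * / N); [|apply Rmult_le_compat_r; lra].
    apply Req_le; field; lra. }
  assert (HNi2 : / N <= / 2) by (apply Rinv_le_contravar; lra).
  assert (EQ' : 1 + 2 * (kappa - 1) / N = 1 + 2 * (kappa / N) - 2 * / N) by (field; lra).
  assert (ES : S0 * S0 = kappa / N) by (apply sqrt_sqrt; lra).
  assert (EQ : Q * Q = 1 + 2 * (kappa / N) - 2 * / N).
  { rewrite <- EQ'; apply sqrt_sqrt; rewrite EQ'; lra. }
  assert (HS0 : 0 <= S0) by apply sqrt_pos.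
  assert (HQ0 : 0 <= Q) by apply sqrt_pos.
  assert (HS : 1 <= 2 * S0) by nra.
  assert (HQS : S0 <= Q) by nra.
  assert (HQS2 : Q <= 2 * S0) by nra.
  assert (HQ : 7 / 5 <= Q) by nra.
  (* The root below 1 of the characteristic equation, checked in [Hchain]. *)
  set (r := (Q - 1) / (Q + 1)).
  assert (Er : 1 - r = 2 / (Q + 1)) by (unfold r; field; lra).
  assert (Hr1 : 0 < 2 / (Q + 1)) by (apply Rdiv_lt_0_compat; lra).
  assert (Hr6 : / 6 <= r).
  { unfold r; apply (Rmult_le_reg_r (Q + 1)); [lra|].
    unfold Rdiv; rewrite Rmult_assoc, Rinv_l by lra; lra. }
  (* Long enough that [r^(2m) <= exp (- 4 m / (Q + 1)) <= exp (- Lam)]. *)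
  destruct (exists_nat_ceil ((Q + 1) * Lam / 4)) as (m & Hm & Hm1 & Hm2); [nra|].
  assert (Hchain : (L - mu) / 2 * ((1 - r) * (1 - r)) = INR n * mu * r).
  { rewrite Er, EL; fold N; unfold r.
    replace kappa with ((Q * Q - 1) * N / 2 + 1) by (rewrite EQ; field; lra).
    field; lra. }
  assert (HmuL : mu <= L) by (rewrite EL; nra).
  destruct (hard_instance n m L mu r Delta A Hn Hm Hmu HmuL ltac:(lra) HDelta Hchain HA)
    as (fs & gfs & prx & xstar & H1 & H2 & H3 & H4 & H5 & H6 & H7).
  exists (S m), fs, gfs, prx, xstar; split; [|repeat (split; [assumption|])].
  - rewrite S_INR; assert (Lam <= 2 * S0 * Lam) by nra.
    assert ((Q + 1) * Lam <= 4 * S0 * Lam) by nra. nra.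
  - intros t Ht; specialize (H7 t).
    assert (Htail : (r * r) ^ m <= exp (- Lam)).
    { assert (Hrexp : r <= exp (- (2 / (Q + 1)))).
      { pose proof (exp_ineq1_le (- (2 / (Q + 1)))); lra. }
      apply Rle_trans with ((exp (- (2 / (Q + 1))) * exp (- (2 / (Q + 1)))) ^ m).
      - apply pow_incr; split; [nra|apply Rmult_le_compat; lra].
      - rewrite <- exp_plus, pow_exp;
        assert (E : INR m * (- (2 / (Q + 1)) + - (2 / (Q + 1))) <= - Lam).
        { apply (Rmult_le_reg_r (Q + 1)); [lra|].
          replace (INR m * (- (2 / (Q + 1)) + - (2 / (Q + 1))) * (Q + 1)) with (- (4 * INR m))
            by (field; lra). lra. }
        destruct E as [E|E]; [left; apply exp_increasing, E|right; rewrite E; reflexivity]. }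
    set (x := 2 / INR n * (1 - r * r)) in *.
    assert (Hx : 0 <= x <= 8 / (N * (Q + 1))).
    { replace (8 / (N * (Q + 1))) with (2 / N * (2 * (1 - r))) by (rewrite Er; field; lra).
      unfold x; fold N; assert (0 < 2 / N) by (apply Rdiv_lt_0_compat; lra).
      split; [apply Rmult_le_pos; nra|apply Rmult_le_compat_l; nra]. }
    (* From [r >= 1/6] and [2 / N <= 1]; this is the range that [pow_ge_exp] demands. *)
    assert (Hx' : x <= 35 / 36).
    { unfold x; fold N; assert (0 < 2 / N <= 1) by (unfold Rdiv; lra). nra. }
    assert (Hsq : sqrt (kappa * N) = N * S0).
    { rewrite <- (sqrt_square N) at 2 by lra; unfold S0; rewrite <- sqrt_mult_alt by nra.
      f_equal; field; lra. }
    assert (Hexpo : INR t * (36 * x) <= Lam / 2).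
    { rewrite Hsq in Ht.
      assert (Ht' : INR t <= / 576 * (N * (Q + 1)) * Lam).
      { apply Rle_trans with (1 := Ht); apply Rmult_le_compat_r; [lra|].
        apply Rmult_le_compat_l; nra. }
      apply Rle_trans with (/ 576 * (N * (Q + 1)) * Lam * (36 * (8 / (N * (Q + 1))))).
      - apply Rmult_le_compat; [apply pos_INR|lra|exact Ht'|lra].
      - apply Req_le; field; lra. }
    assert (Hpow : exp (- (Lam / 2)) <= (1 - x) ^ t).
    { apply Rle_trans with (2 := pow_ge_exp x t (conj (proj1 Hx) Hx')).
      destruct Hexpo as [E|E]; [left; apply exp_increasing; lra|right; rewrite E; reflexivity]. }
    (* [s^2 = eps / Delta], and [s <= 1/3] gives [s - s^2 >= 2 s^2], which absorbs the factor
       [Delta / 2]. *)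
    set (s := exp (- (Lam / 2))) in *.
    assert (Es : exp (- Lam) = s * s) by (unfold s; rewrite <- exp_plus; f_equal; field).
    assert (Hs0 : 0 < s) by apply exp_pos.
    rewrite Es in *.
    assert (Hs3 : s <= / 3) by nra.
    assert (3 * (s * s) <= s) by nra.
    assert (Delta / 2 * (2 * (s * s)) <= Delta / 2 * ((1 - x) ^ t - (r * r) ^ m))
      by (apply Rmult_le_compat_l; lra).
    rewrite Eeps; lra.
Qed.
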